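(* For every infinite cardinal $\mu$, there exists a locally compact group $G$ which is not totally disconnected and such that every non-trivial quotient group of $G$ has local weight at least $2^\mu$ and density at least $\mu$.
   Context: All topological groups are Hausdorff (and not assumed abelian here). A quotient group of $G$ is $G/N$ with the quotient topology, where $N$ is a closed normal subgroup. The local weight of a topological group is the least cardinality of a neighborhood base at the identity. The density of a space is the least cardinality of a dense subset. *)

(* Defs.v *)
From HB Require Import structures.
From mathcomp Require Import all_boot all_algebra.
From mathcomp Require Import all_classical topology.

Set Implicit Arguments.
Unset Strict Implicit.
Unset Printing Implicit Defensive.

Local Open Scope classical_set_scope.
Local Open Scope card_scope.
Local Open Scope quotient_scope.
Local Open Scope group_scope.

HB.mixin Record isTopologicalGroup G & Topological G & Group G := {
  mulg_continuous : continuous (fun x : G * G => x.1 * x.2);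
  invg_continuous : continuous (fun x : G => x^-1)
}.

#[short(type="topologicalGroupType")]
HB.structure Definition TopologicalGroup :=
  {G of Topological G & Group G & isTopologicalGroup G}.

Record normalSubgroup (G : groupType) := NormalSubgroup {
  normal_set :> set G;
  normal1 : normal_set 1;
  normalM : forall x y, normal_set x -> normal_set y -> normal_set (x * y);
  normalV : forall x, normal_set x -> normal_set x^-1;
  normalJ : forall x y, normal_set x -> normal_set (y^-1 * x * y)
}.

Section Coset.
Context {G : groupType} (N : normalSubgroup G).

Definition coset_rel : rel G := fun x y => `[< normal_set N (x^-1 * y) >].

Lemma coset_rel_refl : reflexive coset_rel.
Proof. by move=> x; apply/asboolP; rewrite mulVg; exact: normal1. Qed.

Lemma coset_rel_sym : symmetric coset_rel.
Proof.
move=> x y; apply/asboolP/asboolP => /(@normalV _ N);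
  by rewrite invgM invgK.
Qed.

Lemma coset_rel_trans : transitive coset_rel.
Proof.
move=> y x z /asboolP xy /asboolP yz; apply/asboolP.
by have := normalM xy yz; rewrite -mulgA mulVKg.
Qed.

Canonical coset_equiv :=
  EquivRel coset_rel coset_rel_refl coset_rel_sym coset_rel_trans.

End Coset.

Definition quotient_group (G : topologicalGroupType) (N : normalSubgroup G) :=
  quotient_topology {eq_quot (coset_equiv N)}.

Section QuotientGroup.
Context {G : topologicalGroupType} (N : normalSubgroup G).

Local Notation Q := (quotient_group N).

HB.instance Definition _ := Topological.on Q.
HB.instance Definition _ := Quotient.on Q.

Lemma quot_eqP (x y : G) : \pi_Q x = \pi_Q y <-> normal_set N (x^-1 * y).
Proof.
split=> [/(@eqmodP _ (coset_equiv N) x y) /asboolP //|xy].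
by apply/(@eqmodP _ (coset_equiv N) x y)/asboolP.
Qed.

Lemma quot_ind (P : Q -> Prop) : (forall x, P (\pi_Q x)) -> forall a, P a.
Proof. by move=> H a; rewrite -[a]reprK. Qed.

Definition quot_one : Q := \pi_Q 1.
Definition quot_mul (a b : Q) : Q := \pi_Q (repr a * repr b).
Definition quot_inv (a : Q) : Q := \pi_Q (repr a)^-1.

Lemma quot_mulE (x y : G) : quot_mul (\pi_Q x) (\pi_Q y) = \pi_Q (x * y).
Proof.
apply/quot_eqP.
have /quot_eqP xN : \pi_Q (repr (\pi_Q x)) = \pi_Q x by rewrite reprK.
have /quot_eqP yN : \pi_Q (repr (\pi_Q y)) = \pi_Q y by rewrite reprK.
set x' := repr _ in xN *; set y' := repr _ in yN *.
have := normalM (normalJ y' xN) yN.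
by rewrite invgM !mulgA mulgK.
Qed.

Lemma quot_invE (x : G) : quot_inv (\pi_Q x) = \pi_Q x^-1.
Proof.
apply/quot_eqP; rewrite invgK.
have /quot_eqP xN : \pi_Q x = \pi_Q (repr (\pi_Q x)) by rewrite reprK.
set x' := repr _ in xN *.
by have := normalJ x^-1 xN; rewrite invgK mulVKg.
Qed.

Lemma quot_mulA : associative quot_mul.
Proof.
by move=> a b c; elim/quot_ind: a => x; elim/quot_ind: b => y;
  elim/quot_ind: c => z; rewrite !quot_mulE mulgA.
Qed.

Lemma quot_mul1 : left_id quot_one quot_mul.
Proof. by move=> a; elim/quot_ind: a => x; rewrite quot_mulE mul1g. Qed.

Lemma quot_mulr1 : right_id quot_one quot_mul.
Proof. by move=> a; elim/quot_ind: a => x; rewrite quot_mulE mulg1. Qed.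

Lemma quot_mulV : left_inverse quot_one quot_inv quot_mul.
Proof. by move=> a; elim/quot_ind: a => x; rewrite quot_invE quot_mulE mulVg. Qed.

Lemma quot_mulrV : right_inverse quot_one quot_inv quot_mul.
Proof. by move=> a; elim/quot_ind: a => x; rewrite quot_invE quot_mulE mulgV. Qed.

HB.instance Definition _ := isGroup.Build Q
  quot_mulA quot_mul1 quot_mulr1 quot_mulV quot_mulrV.

Lemma mulgr_continuous (y : G) : continuous (fun x : G => x * y).
Proof.
move=> x; apply: (@continuous_comp _ _ _ (fun x => (x, y)) (fun u => u.1 * u.2)).
  by apply: cvg_pair => /=; [exact: cvg_id|exact: cvg_cst].
exact: mulg_continuous.
Qed.

Lemma quot_pi_open (U : set G) : open U -> open (\pi_Q @` U).
Proof.
move=> oU; rewrite /open /= /quotient_open.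
suff -> : \pi_Q @^-1` (\pi_Q @` U) =
    \bigcup_(n in normal_set N) ((fun x : G => x * n) @^-1` U).
  apply: bigcup_open => n _; apply: open_comp => // x _.
  exact: mulgr_continuous.
apply/seteqP; split=> [x [u Uu /esym/quot_eqP xu]|x [n Nn Uxn]].
  by exists (x^-1 * u) => //=; rewrite mulVKg.
by exists (x * n) => //; apply/esym/quot_eqP; rewrite mulKg.
Qed.

Lemma quot_nbhs_pi (x : G) (U : set G) : nbhs x U -> nbhs (\pi_Q x) (\pi_Q @` U).
Proof.
rewrite nbhsE => -[O [oO Ox] OU]; rewrite nbhsE.
exists (\pi_Q @` O); last exact: image_subset.
by split; [exact: quot_pi_open|exists x].
Qed.

Lemma quot_mul_continuous : continuous (fun x : Q * Q => x.1 * x.2).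
Proof.
move=> [a b]; elim/quot_ind: a => x; elim/quot_ind: b => y U /=.
rewrite [X in nbhs X]quot_mulE => /(@pi_continuous _ _ (x * y)) /=.
move=> /(@mulg_continuous _ (x, y))[[A B] /= [xA yB] AB].
exists (\pi_Q @` A, \pi_Q @` B) => /=; first by split; exact: quot_nbhs_pi.
move=> [_ _] /= [[a Aa <-] [b Bb <-]].
have := AB (a, b) (conj Aa Bb).
by rewrite /= -quot_mulE.
Qed.

Lemma quot_inv_continuous : continuous (fun x : Q => x^-1).
Proof.
apply/quotient_continuous.
rewrite (_ : _ \o _ = \pi_Q \o (fun x : G => x^-1)); last first.
  by apply/funext => x /=; exact: quot_invE.
move=> x; apply: continuous_comp; first exact: invg_continuous.
exact: pi_continuous.
Qed.

HB.instance Definition _ :=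
  isTopologicalGroup.Build Q quot_mul_continuous quot_inv_continuous.

End QuotientGroup.

(* A cardinal is represented by a set having that cardinality, to be used only
   through [#<=], [#>=] and [#=]: [least_card F] is a member of [F] of least
   cardinality.  It exists whenever [F] is nonempty, by [least_cardP]. *)
Definition least_card {T : Type} (F : set (set T)) : set T :=
  get [set A | F A /\ forall B, F B -> A #<= B].

Lemma least_card_ex {T : Type} (F : set (set T)) : F !=set0 ->
  exists A, F A /\ forall B, F B -> A #<= B.
Proof.
move=> [A0 FA0]; pose I := {A : set T | F A}.
pose P (X : set (I -> T)) := (forall h i, X h -> sval i (h i)) /\
  (forall h h' i, X h -> X h' -> h i = h' i -> h = h').
have [|X [[Xin Xinj] Xmax]] := @Zorn_bigcup _ P.
  move=> C CP Ctot; split=> [h i [Y CY Yh]|h h' i [Y CY Yh] [Z CZ Zh']].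
    exact: (CP _ CY).1.
  case: (Ctot _ _ CY CZ) => YZ.
    by apply: (CP _ CZ).2 => //; exact: YZ.
  by apply: (CP _ CY).2 => //; exact: YZ.
have [i iX] : exists i : I, forall a, sval i a -> exists2 h, X h & h i = a.
  apply: contrapT => /forallNP nX.
  have /choice [h0 h0P] : forall i : I, exists a, sval i a /\
      forall h, X h -> h i <> a.
    move=> i; have /existsNP[a /not_implyP[ia na]] := nX i.
    by exists a; split=> // h Xh ha; apply: na; exists h.
  have X0 : ~ X h0.
    by move=> Xh0; apply: ((h0P (exist _ A0 FA0)).2 _ Xh0).
  apply: (Xmax (h0 |` X)); last first.
    split=> [h i [->|/Xin//]|h h' i]; first exact: (h0P i).1.
    move=> [->|Xh] [->|Xh'] //.
    - by move=> /esym /((h0P i).2 _ Xh').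
    - by move=> /((h0P i).2 _ Xh).
    - exact: Xinj.
  by split; [exact: subsetUr|move=> /(_ h0 (or_introl erefl))].
exists (sval i); split=> [|B FB]; first exact: svalP.
have /choice[h hP] : forall a, exists f : I -> T, sval i a -> X f /\ f i = a.
  move=> a.
  have [/iX[f Xf fa]|nia] := pselect (sval i a); first by exists f.
  by exists (fun=> a).
pose j : I := exist _ B FB.
have hinj : {in sval i &, injective (fun a => h a j)}.
  move=> a b /set_mem /hP[Xa ea] /set_mem /hP[Xb eb] /= eab.
  by rewrite -ea -eb (Xinj _ _ _ Xa Xb eab).
rewrite -(card_le_eql (inj_card_eq hinj)); apply: subset_card_le.
by move=> _ [a /hP[/(Xin _ j) Bj _] <-].
Qed.

Lemma least_cardP {T : Type} (F : set (set T)) : F !=set0 ->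
  F (least_card F) /\ forall B, F B -> least_card F #<= B.
Proof.
by move=> /least_card_ex exF;
  exact: (@getPex _ [set A | F A /\ forall B, F B -> A #<= B] exF).
Qed.

Definition nbhs_base {T : topologicalType} (x : T) (B : set (set T)) :=
  B `<=` nbhs x /\ forall U, nbhs x U -> exists2 V, B V & V `<=` U.

Definition local_weight (G : topologicalGroupType) : set (set G) :=
  least_card (nbhs_base (1 : G)).
Arguments local_weight G : clear implicits.

Definition density (T : topologicalType) : set T := least_card (@dense T).
Arguments density T : clear implicits.

Lemma local_weightP (G : topologicalGroupType) :
  nbhs_base (1 : G) (local_weight G) /\
  forall B, nbhs_base (1 : G) B -> local_weight G #<= B.
Proof.
apply: least_cardP; exists (nbhs (1 : G)); split=> // U nU.
by exists U.
Qed.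

Lemma densityP (T : topologicalType) :
  dense (density T) /\ forall D : set T, dense D -> density T #<= D.
Proof.
by apply: least_cardP; exists [set: T] => O O0 _; rewrite setIT.
Qed.

(* Main.v *)
Require Import Defs.
From mathcomp Require Import all_boot all_algebra.
From mathcomp Require Import all_classical topology.
From HB Require Import structures.
From mathcomp Require Import all_order reals normedtype Rstruct ring lra.

(** The group is [G = T ^ Om ><| H], where [T] is the circle group,
    [J = P(P(M * 2))], [Om = J * {0, 1}] is partitioned into the two-point blocks
    [{j} * {0, 1}], and [H] is the group of the permutations of [Om] that
    preserve all but finitely many blocks.  The permutations that preserve every
    block form a compact group [U = (Z/2) ^ J], which is commensurated by [H]; so
    [H] has a locally compact group topology in which [U] is open, with its
    product topology.  Then [T ^ Om * U] is a compact open neighbourhood in [G],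
    and the constant functions form a copy of the circle, so [G] is not totally
    disconnected.

    Everything rests on a dichotomy: a closed normal subgroup [N] of [G] is either
    contained in [T ^ Om] or equal to [G] ([normal_dichotomy]).  Suppose that
    some [n] in [N] moves a point of [Om].
    - Commutators of [n] with the elements of [T ^ Om] supported at one point
      give the elements of [N] with the value [c] at [x], [c^-1] at [y] and 1
      elsewhere.  As [y] can be chosen outside any finite set and [N] is closed,
      [N] contains [T ^ Om] ([normal_diag]); membership in [N] then depends on the
      permutation only ([normal_act]).
    - Commutators with transpositions give an element of [N] that moves a point
      and fixes almost all points ([finitely_moving]), and from it all products
      of two disjoint transpositions of points outside some finite set
      ([double_transposition]).  In particular [N] contains products of the flips
      of two blocks; when the second block leaves every finite set, these tend to
      the flip of the first block, because [U] has the product topology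
      ([normal_flip]).
    - So [N] contains one transposition, hence all of them, hence [U] as a limit
      of finite products, and finally [G] ([normal_all]).

    If [N] is contained in [T ^ Om], then [G / N] acts on [Om], with open
    stabilizers.  It acts transitively, so a dense subset has at least as many
    elements as [Om] ([quotient_density]).  For each [j] the stabilizer of
    [(j, 0)] contains a member of a given neighbourhood base at 1, and one member
    can be used for finitely many [j] only, since each neighbourhood of 1 contains
    the flips of almost all blocks.  Thus [J] maps to the base with finite
    fibers.  If the base had at most [2 ^ M] elements, [J = P(P(M * 2))] would embed
    into [P(M * 2)], against Cantor's theorem; as cardinals are comparable, the
    base has at least [2 ^ M] elements ([quotient_local_weight]). *)

Set Implicit Arguments.
Unset Strict Implicit.
Unset Printing Implicit Defensive.

(** * The group of twisted permutations *)

Section TwistedPerm.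
Local Open Scope classical_set_scope.

(** An element of [T ^ Om ><| H], for [Om = J * bool]: the permutation [act] of
    [Om] sends almost every point to its own block, and [twist] is the component
    in [T ^ Om].  The element stands for the bijection
    [(w, c) |-> (act w, twist (act w) * c)] of [Om * T].  The inverse [actV] of
    [act] is stored so that inversion needs no choice. *)
Record twisted_perm (J : choiceType) (T : topologicalGroupType) := TwistedPerm {
  act : J * bool -> J * bool;
  actV : J * bool -> J * bool;
  twist : J * bool -> T;
  actK : cancel act actV;
  actVK : cancel actV act;
  act_fin : finite_set [set w | (act w).1 != w.1] }.

End TwistedPerm.

HB.instance Definition _ J T := gen_eqMixin (twisted_perm J T).
HB.instance Definition _ J T := gen_choiceMixin (twisted_perm J T).

Section Group.
Local Open Scope classical_set_scope.
Local Open Scope group_scope.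
Context {J : choiceType} {T : topologicalGroupType}.
Local Notation Om := (J * bool)%type.
Local Notation G := (twisted_perm J T).
Implicit Types (g h : G) (w : Om).

Lemma twisted_perm_eq g h : act g =1 act h -> twist g =1 twist h -> g = h.
Proof.
case: g h => [a a' t aK a'K af] [b b' u bK b'K bf] /= /funext ab /funext tu.
subst b u; have ab' : a' = b' by apply/funext => w; rewrite -[w in LHS]b'K aK.
by subst b'; congr TwistedPerm; exact: Prop_irrelevance.
Qed.

Lemma act_inj g : injective (act g).
Proof. exact: can_inj (actK g). Qed.

Lemma actV_fin g : finite_set [set w | (actV g w).1 != w.1].
Proof.
apply: sub_finite_set (finite_image (act g) (act_fin g)) => w /= gw.
by exists (actV g w) => /=; rewrite ?actVK // eq_sym.
Qed.

Lemma mul_fin g h : finite_set [set w | (act g (act h w)).1 != w.1].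
Proof.
have : finite_set ((actV h @` [set w | (act g w).1 != w.1]) `|`
    [set w | (act h w).1 != w.1]).
  by rewrite finite_setU; split; [exact/finite_image/act_fin|exact: act_fin].
apply: sub_finite_set => w /= ghw.
have [hw|hw] := eqVneq (act h w).1 w.1; last by right.
by left; exists (act h w) => /=; rewrite ?actK // hw.
Qed.

Lemma one_fin : finite_set [set w : Om | w.1 != w.1].
Proof. by apply: sub_finite_set (finite_set0 Om) => w /=; rewrite eqxx. Qed.

Definition tp_one : G := @TwistedPerm J T id id (fun=> 1)
  (fun=> erefl) (fun=> erefl) one_fin.

Definition tp_mul g h : G := @TwistedPerm J T
  (act g \o act h) (actV h \o actV g)
  (fun w => twist g w * twist h (actV g w))
  (can_comp (actK g) (actK h)) (can_comp (actVK h) (actVK g)) (mul_fin g h).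

Definition tp_inv g : G := @TwistedPerm J T (actV g) (act g)
  (fun w => (twist g (act g w))^-1) (actVK g) (actK g) (actV_fin g).

Lemma tp_mulA : associative tp_mul.
Proof. by move=> g h k; apply: twisted_perm_eq => w //=; rewrite mulgA. Qed.

Lemma tp_mul1 : left_id tp_one tp_mul.
Proof. by move=> g; apply: twisted_perm_eq => w //=; rewrite mul1g. Qed.

Lemma tp_mulr1 : right_id tp_one tp_mul.
Proof. by move=> g; apply: twisted_perm_eq => w //=; rewrite mulg1. Qed.

Lemma tp_mulV : left_inverse tp_one tp_inv tp_mul.
Proof.
by move=> g; apply: twisted_perm_eq => w /=; rewrite ?actK // mulVg.
Qed.

Lemma tp_mulrV : right_inverse tp_one tp_inv tp_mul.
Proof.
by move=> g; apply: twisted_perm_eq => w /=; rewrite actVK // mulgV.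
Qed.

HB.instance Definition _ := isGroup.Build G
  tp_mulA tp_mul1 tp_mulr1 tp_mulV tp_mulrV.

Lemma actM g h w : act (g * h) w = act g (act h w). Proof. by []. Qed.
Lemma act_inv g : act g^-1 = actV g. Proof. by []. Qed.
Lemma actV_inv g : actV g^-1 = act g. Proof. by []. Qed.
Lemma twistM g h w : twist (g * h) w = twist g w * twist h (actV g w).
Proof. by []. Qed.
Lemma twistV g w : twist g^-1 w = (twist g (act g w))^-1. Proof. by []. Qed.

Lemma act_near_seq g : exists s : seq Om, forall w, w \notin s -> (act g w).1 = w.1.
Proof.
have /finite_seqP[s sE] := act_fin g.
exists s => w ws; apply/eqP; apply: contraNT ws => gw.
by have : [set` s] w by rewrite -sE.
Qed.

(** The topology of [G].  A basic neighbourhood of [g] consists of the [h] that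
    agree with [g] on a finite set of points, have a twist close to that of [g]
    there, and satisfy [h \in g * (T ^ Om * U)].  The last condition says that
    [act g] and [act h] carry the partition of [Om] into blocks to the same
    labelled partition, i.e. that [actV g] and [actV h] have the same block
    components. *)
Definition tp_nbhs g : set_system G := fun A =>
  exists (s : seq Om) (V : Om -> set T),
    (forall w, nbhs (twist g w) (V w)) /\
    forall h, (forall w, w \in s -> act h w = act g w /\ V w (twist h w)) ->
      (forall w, (actV h w).1 = (actV g w).1) -> A h.

HB.instance Definition _ := hasNbhs.Build G tp_nbhs.

Lemma tp_nbhs_singleton g (A : set G) : nbhs g A -> A g.
Proof.
move=> [s [V [Vg]]]; apply=> // w _; split=> //; exact: nbhs_singleton.
Qed.

Lemma tp_nbhs_filter g : ProperFilter (nbhs g).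
Proof.
apply: Build_ProperFilter_ex => [A /tp_nbhs_singleton ?|]; first by exists g.
split=> [|A B|A B AB].
- by exists [::], (fun=> setT); split=> // w; exact: filterT.
- move=> [s [V [Vg sVA]]] [s' [V' [Vg' sVB]]].
  exists (s ++ s'), (fun w => V w `&` V' w); split=> [w|h hs hq].
    exact: filterI.
  by split; [apply: sVA|apply: sVB] => // w ws;
    have [|? []] := hs w; rewrite // mem_cat ws ?orbT.
- move=> [s [V [Vg sVA]]]; exists s, V; split=> // h hs hq; exact/AB/sVA.
Qed.

Lemma tp_nbhs_nbhs g (A : set G) : nbhs g A -> nbhs g (nbhs^~ A).
Proof.
move=> [s [V [Vg sVA]]]; exists s, (fun w => (V w)^°).
split=> [w|h hs hq]; first exact/nbhs_interior.
exists s, (fun w => if w \in s then V w else setT); split=> [w|k ks kq].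
  by case: ifPn => [/hs[]//|_]; exact: filterT.
apply: sVA => w => [ws|]; last by rewrite kq.
by have [+ _] := hs _ ws; have := ks _ ws; rewrite ws => -[-> ?] ->.
Qed.

HB.instance Definition _ := Nbhs_isNbhsTopological.Build G
  tp_nbhs_filter tp_nbhs_singleton tp_nbhs_nbhs.

(** For [g'] near [g] and [h'] near [h], the block of [actV (g' * h') w] must be
    that of [actV (g * h) w].  Here [actV g' w] and [actV g w] lie in the same
    block, and [actV h] preserves blocks outside a finite set [E]; on [E] the
    permutation [act g'] is required to agree with [act g]. *)
Lemma tp_mul_continuous : continuous (fun x : G * G => x.1 * x.2).
Proof.
move=> [g h] A /= [s [V [Vgh sVA]]].
have /choice[V12 V12P] w : exists V12 : set T * set T,
    [/\ nbhs (twist g w) V12.1, nbhs (twist h (actV g w)) V12.2 &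
    forall x y, V12.1 x -> V12.2 y -> V w (x * y)].
  have [[V1 V2] /= [V1n V2n] V12] :=
    @mulg_continuous T (twist g w, twist h (actV g w)) _ (Vgh w).
  by exists (V1, V2); split=> // x y V1x V2y; exact: (V12 (x, y)).
have [E EP] := act_near_seq h^-1.
exists (([set g' | (forall w, w \in map (act h) s ++ s ++ map (actV g) s ++ E ->
     act g' w = act g w /\ (V12 w).1 (twist g' w)) /\
     forall w, (actV g' w).1 = (actV g w).1]),
  ([set h' | (forall w, w \in s ++ map (actV g) s ->
     act h' w = act h w /\ (V12 (act g w)).2 (twist h' w)) /\
     forall w, (actV h' w).1 = (actV h w).1])) => /=.
  split.
    by exists (map (act h) s ++ s ++ map (actV g) s ++ E), (fun w => (V12 w).1);
      split=> // w; case: (V12P w).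
  exists (s ++ map (actV g) s), (fun w => (V12 (act g w)).2); split=> // w.
  by case: (V12P (act g w)); rewrite actK.
move=> [g' h'] /= [[gs gq] [hs hq]]; apply: sVA => w => [ws|].
  have [|hw _] := hs w; first by rewrite mem_cat ws.
  split; rewrite ?actM ?hw.
    by have [] // := gs (act h w); rewrite mem_cat map_f.
  have [|_ V1g] := gs w; first by rewrite !mem_cat ws orbT.
  have gVw : actV g' w = actV g w.
    have [|+ _] := gs (actV g w); first by rewrite !mem_cat map_f ?orbT.
    by rewrite actVK => gw; rewrite -{1}gw actK.
  rewrite twistM gVw.
  have [|_ V2h] := hs (actV g w); first by rewrite !mem_cat map_f ?orbT.
  by case: (V12P w) => _ _; apply=> //; rewrite actVK in V2h.
rewrite /= hq; set a := actV g' w; set b := actV g w.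
have [aE|aE] := boolP (a \in E).
  have [|+ _] := gs a; first by rewrite !mem_cat aE !orbT.
  by rewrite actVK => wga; rewrite /b wga actK.
have [bE|bE] := boolP (b \in E).
  have [|+ _] := gs b; first by rewrite !mem_cat bE !orbT.
  by rewrite actVK => wgb; rewrite /a -wgb actK.
by have := EP _ aE; have := EP _ bE; rewrite act_inv => -> ->; exact: gq.
Qed.

Lemma tp_inv_continuous : continuous (fun g : G => g^-1).
Proof.
move=> g A /= [s [V [Vg sVA]]].
have [E EP] := act_near_seq g.
exists (map (actV g) s ++ s ++ map (act g) s ++ E).
exists (fun w => [set x | V (actV g w) x^-1]); split=> [w|h hs hq].
  have := Vg (actV g w); rewrite twistV actVK.
  exact: (@invg_continuous T).
apply: sVA => w => [ws|].
  split.
    have [|+ _] := hs (actV g w); first by rewrite !mem_cat map_f.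
    by rewrite !act_inv actVK => hw; rewrite -{1}hw actK.
  have [|gw _] := hs w; first by rewrite !mem_cat ws ?orbT.
  have [|_] := hs (act g w); first by rewrite !mem_cat map_f ?orbT.
  by rewrite twistV gw /= actK.
rewrite !actV_inv; have [wE|wE] := boolP (w \in E).
  by have [|-> _] := hs w; rewrite // !mem_cat wE !orbT.
have := hq (act h w); rewrite actK; set b := actV g _ => wb.
have gb : act g b = act h w by rewrite actVK.
have [bE|bE] := boolP (b \in E).
  have [|hb _] := hs b; first by rewrite !mem_cat bE !orbT.
  by move: gb; rewrite -hb => /act_inj bw; rewrite -bw hb.
by rewrite -gb !EP.
Qed.

HB.instance Definition _ :=
  isTopologicalGroup.Build G tp_mul_continuous tp_inv_continuous.

End Group.

(** * Topological properties of the group *)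

Section Topology.
Local Open Scope classical_set_scope.
Local Open Scope group_scope.
Context {J : choiceType} {T : topologicalGroupType}.
Local Notation Om := (J * bool)%type.
Local Notation G := (twisted_perm J T).
Implicit Types (g h : G) (w : Om).

Lemma near_act g w : \forall h \near g, act h w = act g w.
Proof.
exists [:: w], (fun=> setT); split=> [v|h hs _]; first exact: filterT.
by have [] := hs w; rewrite ?mem_head.
Qed.

Lemma open_act w v : open [set g : G | act g w = v].
Proof. by rewrite openE => g <-; exact: near_act. Qed.

Lemma twist_continuous w : continuous (fun g : G => twist g w).
Proof.
move=> g A Ag; exists [:: w], (fun v => if v == w then A else setT).
split=> [v|h hs _]; first by case: eqP => [->|_]; last exact: filterT.
by have [|_] := hs w; rewrite ?mem_head // eqxx.
Qed.

Lemma tp_hausdorff : hausdorff_space T -> hausdorff_space G.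
Proof.
move=> hT g h gh; apply: twisted_perm_eq => w.
  have [k [-> //]] := gh _ _ (near_act g w) (near_act h w).
apply: hT => A B Ag Bh.
have [k [Ak Bk]] := gh _ _ (twist_continuous Ag) (twist_continuous Bh).
by exists (twist k w).
Qed.

Lemma near_seq (X : Type) (I : eqType) (F : set_system X) (A : I -> set X)
    (s : seq I) {FF : Filter F} : (forall i, F (A i)) ->
  F [set x | forall i, i \in s -> A i x].
Proof.
move=> FA; elim: s => [|i s IH]; first exact: filterE.
apply: filterS2 (FA i) IH => x Aix Asx j.
by rewrite inE => /predU1P[->//|]; exact: Asx.
Qed.

(** The element of [U = (Z/2) ^ J] that swaps the two points of the block of [j]
    exactly when [u j] holds. *)
Definition flips (u : J -> bool) w : Om := (w.1, w.2 (+) u w.1).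

Lemma flipsK u : involutive (flips u).
Proof. by move=> [j b]; rewrite /flips /= addbK. Qed.

Lemma flips_fin u : finite_set [set w | (flips u w).1 != w.1].
Proof. by apply: sub_finite_set (finite_set0 Om) => w /=; rewrite eqxx. Qed.

(** The parametrization of the compact open subgroup [T ^ Om * U] by the product
    space [T ^ Om * {0, 1} ^ J]. *)
Definition tp_flips (x : {ptws Om -> T} * {ptws J -> bool}) : G :=
  @TwistedPerm J T (flips x.2) (flips x.2) x.1
    (flipsK x.2) (flipsK x.2) (flips_fin x.2).

Lemma tp_flips_continuous : continuous tp_flips.
Proof.
move=> [t u] A /= [s [V [Vt sVA]]].
pose s' := map fst s.
exists ([set t' | forall w, w \in s -> V w (t' w)],
    [set u' | forall j, j \in s' -> u' j = u j]) => /=.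
  split.
    apply: (@near_seq _ _ _ (fun w (t : {ptws Om -> T}) => V w (t w)) s
      (nbhs_filter t)) => i.
    have := (@proj_continuous Om (fun _ : Om => T) i t (V i) (Vt i)).
    exact.
  apply: (@near_seq _ _ _ (fun j (u' : {ptws J -> bool}) => u' j = u j) s'
    (nbhs_filter u)) => i.
  have := (@proj_continuous J (fun _ : J => bool) i u [set u i]). exact.
move=> [t' u'] /= [t's u's]; apply: sVA => w //= ws; split; last exact: t's.
by rewrite /flips /= u's // map_f.
Qed.

Lemma tp_flips_range : range tp_flips = [set g | forall w, (act g w).1 = w.1].
Proof.
apply/seteqP; split=> [_ [[t u] _ <-] //|g /= gq].
exists (twist g, fun j => (act g (j, false)).2) => //.
apply: twisted_perm_eq => //= -[j b]; rewrite /flips /=.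
have E b' : act g (j, b') = (j, (act g (j, b')).2).
  by rewrite [LHS]surjective_pairing gq.
have ne : (act g (j, false)).2 <> (act g (j, true)).2.
  by move=> e; have := E true; rewrite -e -E => /act_inj.
rewrite [RHS]E; congr pair; case: b => //=.
by move: ne; case: (act g (j, false)).2; case: (act g (j, true)).2.
Qed.

Lemma tp_locally_compact : compact [set: T] -> hausdorff_space T ->
  locally_compact [set: G].
Proof.
move=> cT hT g _; rewrite withinET; pose U := range tp_flips.
have cU : compact U.
  apply: continuous_compact.
    by apply: continuous_subspaceT; exact: tp_flips_continuous.
  rewrite -setXTT; apply: compact_setX.
    have := @tychonoff Om (fun=> T) (fun=> setT) (fun=> cT).
    by congr compact; apply/seteqP; split.
  have := @tychonoff J (fun=> bool) (fun=> setT) (fun=> bool_compact).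
  by congr compact; apply/seteqP; split.
have cg : continuous (fun h : G => g * h).
  move=> h A /(@mulg_continuous _ (g, h))[[B C] /= [Bg Ch] BC].
  apply: filterS Ch => k Ck; apply: (BC (g, k)).
  by split=> //; exact: nbhs_singleton Bg.
have cgU := continuous_compact (continuous_subspaceT cg) cU.
exists ((fun h => g * h) @` U).
  exists [::], (fun=> setT); split=> [w|h _ hq]; first exact: filterT.
  exists (g^-1 * h); last by rewrite mulVKg.
  by rewrite /U tp_flips_range => w /=; rewrite -hq actK.
by split=> //; apply: compact_closed => //; exact: tp_hausdorff.
Qed.

Lemma tp_not_totally_disconnected (x : J) (C : set T) (a b : T) :
  connected C -> C a -> C b -> a <> b -> ~ totally_disconnected [set: G].
Proof.
move=> cC Ca Cb ab td.
pose f (c : T) : G := tp_flips (fun=> c, fun=> false).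
have cf : continuous f.
  move=> c A [s [V [Vc sVA]]].
  have Ac := @near_seq _ _ _ V s (nbhs_filter c) Vc.
  apply: filterS Ac => d Vd; apply: sVA => // w ws; split=> //; exact: Vd.
have fC : connected (f @` C).
  exact: (connected_continuous_connected cC (continuous_subspaceT cf)).
have fab : [set f a] (f b).
  apply: (_ : f @` C `<=` [set f a]); last by exists b.
  rewrite -(td (f a)) //; apply: connected_component_max => //; by exists a.
by apply: ab; have := congr1 (fun g => twist g (x, true)) fab.
Qed.

End Topology.

(** * Transpositions *)

Section Swap.
Context {I : eqType}.
Implicit Types x y z v : I.

(** The transposition of [x] and [y], the identity if [x = y]. *)
Definition swap x y v := if v == x then y else if v == y then x else v.

Lemma swapL x y : swap x y x = y.
Proof. by rewrite /swap eqxx. Qed.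

Lemma swapR x y : swap x y y = x.
Proof. by rewrite /swap eqxx; case: eqP. Qed.

Lemma swapD x y v : v != x -> v != y -> swap x y v = v.
Proof. by rewrite /swap => /negPf-> /negPf->. Qed.

Lemma swapK x y : involutive (swap x y).
Proof.
move=> v; have [->|vx] := eqVneq v x; first by rewrite swapL swapR.
have [->|vy] := eqVneq v y; first by rewrite swapR swapL.
by rewrite !swapD.
Qed.

Lemma conj_swap (f f' : I -> I) x y v : cancel f f' -> cancel f' f ->
  f (swap x y (f' v)) = swap (f x) (f y) v.
Proof.
move=> fK f'K; rewrite /swap -(can2_eq f'K fK) -(can2_eq f'K fK).
by case: ifP => // _; case: ifP => // _; rewrite f'K.
Qed.

(** Transpositions act transitively on the pairs of distinct points. *)
Lemma swap_2transitive (R : I -> I -> Prop) x0 y0 :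
  (forall a b x y, R x y -> R (swap a b x) (swap a b y)) ->
  R x0 y0 -> x0 != y0 -> forall x y, x != y -> R x y.
Proof.
move=> Rs R0 xy0.
have R1 z : z != x0 -> R x0 z.
  rewrite eq_sym => zx0; have := Rs y0 z _ _ R0.
  by rewrite swapL (swapD xy0 zx0).
move=> x y; have [->|xx0] := eqVneq x x0; first by rewrite eq_sym; exact: R1.
move=> xy.
have [->|yx0] := eqVneq y x0.
  by have := Rs x0 x _ _ (R1 _ xx0); rewrite swapL swapR.
have := Rs x0 x _ _ (R1 _ yx0); rewrite swapL swapD //.
by rewrite eq_sym.
Qed.

(** With [d z] for the 3-cycle [(y z) (x z)], this is [d z \o d z' = (x z) (y z')]:
    the two 3-cycles share [x] and [y]. *)
Lemma swap4 x y z z' v : x != y -> z != x -> z != y -> z' != x -> z' != y ->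
    z != z' ->
  swap y z (swap x z (swap y z' (swap x z' v))) = swap x z (swap y z' v).
Proof.
move=> xy zx zy z'x z'y zz'.
have neqC (a b : I) : a != b -> b != a by rewrite eq_sym.
have [[yx xz] yz] := (neqC _ _ xy, neqC _ _ zx, neqC _ _ zy).
have [[xz' yz'] z'z] := (neqC _ _ z'x, neqC _ _ z'y, neqC _ _ zz').
have [->|vx] := eqVneq v x.
  by rewrite swapL swapR (swapD yx yz) swapL (swapD xy xz') swapL.
have [->|vy] := eqVneq v y.
  by rewrite (swapD yx yz') swapL (swapD z'x z'z) (swapD z'y z'z).
have [->|vz] := eqVneq v z.
  by rewrite (swapD zx zz') (swapD zy zz') swapR (swapD xy xz).
have [->|vz'] := eqVneq v z'.
  by rewrite swapR (swapD xy xz') swapL !swapR (swapD yx yz).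
by rewrite !swapD.
Qed.

End Swap.

(** * Closed normal subgroups *)

Section Dichotomy.
Local Open Scope classical_set_scope.
Local Open Scope group_scope.
Context {J : choiceType} {T : topologicalGroupType}.
Local Notation Om := (J * bool)%type.
Local Notation G := (twisted_perm J T).
Hypothesis infJ : infinite_set [set: J].
Hypothesis mulTC : commutative (fun x y : T => x * y).
Variable NS : normalSubgroup G.
Local Notation N := (normal_set NS).
Hypothesis clN : closed N.
Implicit Types (g h n : G) (x y z v w : Om) (s : seq Om).

Lemma freshJ (s : seq J) : exists j, j \notin s.
Proof.
apply: contrapT => /forallNP ns; apply: infJ; apply/finite_seqP; exists s.
by apply/seteqP; split=> // j _; have /negP/negPn := ns j.
Qed.

Lemma fresh s : exists w, w \notin s.
Proof.
have [j js] := freshJ (map fst s); exists (j, false).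
by apply: contra js => ?; apply/mapP; exists (j, false).
Qed.

Lemma swap_fin x y : finite_set [set w | (swap x y w).1 != w.1].
Proof.
apply: sub_finite_set (finite_seq [:: x; y]) => w /=; rewrite !inE.
by apply: contraR; rewrite negb_or => /andP[? ?]; rewrite swapD.
Qed.

(** The transposition of [x] and [y], with trivial twist. *)
Definition tr x y : G := @TwistedPerm J T (swap x y) (swap x y) (fun=> 1)
  (swapK x y) (swapK x y) (swap_fin x y).

(** The element [t] of the normal subgroup [T ^ Om]. *)
Definition diag (t : Om -> T) : G := @TwistedPerm J T id id t
  (fun=> erefl) (fun=> erefl) one_fin.

(** The function with the values [c] at [x] and [c^-1] at [y], and 1 elsewhere. *)
Definition ddelta x y (c : T) : Om -> T :=
  fun w => if w == x then c else if w == y then c^-1 else 1.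

(** In terms of the basic neighbourhoods: a limit of elements of [A] is in [A]. *)
Lemma closed_approx (A : set G) g : closed A ->
  (forall s, exists n, [/\ A n,
    forall w, w \in s -> act n w = act g w /\ twist n w = twist g w &
    forall w, (actV n w).1 = (actV g w).1]) -> A g.
Proof.
move=> clA Ag; apply: clA => B [s [V [Vg sVB]]].
have [n [An ns nq]] := Ag s; exists n; split=> //; apply: sVB => // w ws.
by have [-> ->] := ns _ ws; split=> //; exact: nbhs_singleton.
Qed.

Lemma normal_conj g n : N n -> N (g * n * g^-1).
Proof. by move=> Nn; rewrite -{1}[g]invgK; exact: normalJ. Qed.

Lemma normal_comm g n : N n -> N (n * g * n^-1 * g^-1).
Proof.
move=> Nn; rewrite -!mulgA; apply: normalM => //; rewrite !mulgA.
by apply: normal_conj; exact: normalV.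
Qed.

Section Moving.
Variables (n0 : G) (x0 : Om).
Hypotheses (Nn0 : N n0) (n0x0 : act n0 x0 != x0).

(** For [x = x0] and [y = act n0 x0] this is, up to inversion, the commutator of
    [n0] with the function supported at [x0], because [T] is commutative. *)
Lemma normal_ddelta x y c : x != y -> N (diag (ddelta x y c)).
Proof.
apply: (@swap_2transitive _ (fun x y => N (diag (ddelta x y c))) x0 (act n0 x0)).
- move=> a b {}x {}y /(normal_conj (tr a b)).
  congr (N _); apply: twisted_perm_eq => w /=; first by rewrite swapK.
  rewrite mul1g invg1 mulg1 /ddelta.
  by rewrite !(can2_eq (swapK a b) (swapK a b)).
- have := normalV (normal_comm (diag (fun w => if w == x0 then c else 1)) Nn0).
  congr N; apply: twisted_perm_eq => w; first by rewrite /= actVK.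
  rewrite /= !actVK ?actK !invgM !invgK.
  rewrite (mulTC (twist n0 w)) /= mulgVK /ddelta.
  rewrite (can2_eq (actVK n0) (actK n0)); have [->|_] := eqVneq w x0.
    by rewrite eq_sym (negPf n0x0) invg1 mulg1.
  by rewrite mul1g; case: eqP => // _; rewrite invg1.
- by rewrite eq_sym.
Qed.

(** On a finite set [s], the function [t] is a product of functions
    [ddelta a y (t a)], for one [y] outside [s]. *)
Lemma normal_diag t : N (diag t).
Proof.
apply: closed_approx => // s; have [y ys] := fresh s.
suff [u [Nu us _]] : exists u : Om -> T, [/\ N (diag u),
    forall w, w \in s -> u w = t w & forall w, w \notin s -> w != y -> u w = 1].
  by exists (diag u); split=> // w ws /=; rewrite us.
elim: s ys => [_|a s IH].
  exists (fun=> 1); split=> //; suff -> : diag (fun=> 1) = 1 by exact: normal1.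
  exact: twisted_perm_eq.
rewrite inE negb_or => /andP[ya ys]; have [u [Nu us u1]] := IH ys.
have [as_|as_] := boolP (a \in s).
  exists u; split=> // w; rewrite inE; first by case/predU1P => [->|]; exact: us.
  by rewrite negb_or => /andP[_]; exact: u1.
exists (fun w => u w * ddelta a y (t a) w); split.
- have ay : a != y by rewrite eq_sym.
  have := normalM Nu (normal_ddelta (t a) ay).
  by congr N; exact: twisted_perm_eq.
- move=> w; rewrite inE /ddelta; have [->|wa /= ws] := eqVneq w a.
    by rewrite u1 ?mul1g // eq_sym.
  have [wy|_] := eqVneq w y; first by rewrite wy (negPf ys) in ws.
  by rewrite mulg1 us.
- move=> w; rewrite inE negb_or => /andP[wa ws] wy.
  by rewrite /ddelta (negPf wa) (negPf wy) mulg1 u1.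
Qed.

(** Since [N] contains [T ^ Om], membership in [N] depends on the permutation
    only. *)
Lemma normal_act g n : act n =1 act g -> N n -> N g.
Proof.
move=> ng Nn.
have := normalM (normal_diag (fun w => twist g w * (twist n w)^-1)) Nn.
congr N; apply: twisted_perm_eq => w; first exact: ng.
by rewrite twistM /= mulgVK.
Qed.

Lemma act_conj_tr g x y w :
  act (g * tr x y * g^-1) w = swap (act g x) (act g y) w.
Proof. by rewrite -(conj_swap _ _ _ (actK g) (actVK g)). Qed.

Lemma act_conj_tr2 g a b c d w : act (g * (tr a b * tr c d) * g^-1) w =
  swap (act g a) (act g b) (swap (act g c) (act g d) w).
Proof.
rewrite -(conj_swap c d w (actK g) (actVK g)).
by rewrite -(conj_swap a b _ (actK g) (actVK g)) actK.
Qed.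

Lemma act_comm_tr g x y w : act (g * tr x y * g^-1 * (tr x y)^-1) w =
  swap (act g x) (act g y) (swap x y w).
Proof. by rewrite actM act_conj_tr. Qed.

(** The element is the commutator of [n0] with a transposition [(x0 w)]. *)
Lemma finitely_moving : exists n x s,
  [/\ N n, act n x != x & forall w, w \notin s -> act n w = w].
Proof.
(* by this choice of w, the commutator maps w to x0 *)
have [w] := fresh [:: x0; actV n0 x0].
rewrite !inE negb_or => /andP[wx0 wVx0].
exists (n0 * tr x0 w * n0^-1 * (tr x0 w)^-1), w.
exists [:: x0; w; act n0 x0; act n0 w]; split; first exact: normal_comm.
  rewrite act_comm_tr swapR swapD; first by rewrite eq_sym.
    by rewrite eq_sym.
  by rewrite -(can2_eq (actVK n0) (actK n0)) eq_sym.
move=> v; rewrite !inE !negb_or => /and4P[vx0 vw vn0x0 vn0w].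
by rewrite act_comm_tr !swapD.
Qed.

(** If [n] moves [x] to [y] and fixes [z] and [z'], the commutators of [n] with
    [(x z)] and [(x z')] are 3-cycles whose product is [(x z) (y z')].
    Conjugation then replaces [x] and [y] by other points. *)
Lemma double_transposition : exists s, forall a b c d,
  uniq [:: a; b; c; d] -> all (fun w => w \notin s) [:: a; b; c; d] ->
  N (tr a b * tr c d).
Proof.
have [n [x [s [Nn nx ns]]]] := finitely_moving; set y := act n x in nx.
have xs : x \in s by apply: contraNT nx => /ns/eqP.
have ys : y \in s by apply: contraNT nx => /ns/act_inj/eqP.
have xy : x != y by rewrite eq_sym.
have D z : z \notin s -> [/\ z != x, z != y & act n z = z].
  move=> zs; split; last exact: ns.
    by apply: contraNneq zs => ->.
  by apply: contraNneq zs => ->.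
have xzyz' z z' : z != z' -> z \notin s -> z' \notin s -> N (tr x z * tr y z').
  move=> zz' /D[zx zy nz] /D[z'x z'y nz'].
  have := normalM (normal_comm (tr x z) Nn) (normal_comm (tr x z') Nn).
  apply: normal_act => v; rewrite [LHS]actM !act_comm_tr nz nz' -/y.
  exact: swap4.
exists s => a b c d /=; rewrite !inE !negb_or !andbT.
move=> /and3P[/and3P[ab ac ad] /andP[bc bd] cd] /and4P[as_ bs cs ds].
have neqC (u v : Om) : u != v -> v != u by rewrite eq_sym.
have := normal_conj (tr x a * tr y c) (xzyz' b d bd bs ds).
apply: normal_act => v; rewrite act_conj_tr2 !actM /=.
have [ax ay _] := D _ as_; have [bx by_ _] := D _ bs.
have [cx cy _] := D _ cs; have [dx dy _] := D _ ds.
rewrite (swapD xy (neqC _ _ cx)) !swapL (swapD cx (neqC _ _ ac)).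
rewrite (swapD by_ bc) (swapD bx (neqC _ _ ab)).
by rewrite (swapD dy (neqC _ _ cd)) (swapD dx (neqC _ _ ad)).
Qed.

(** The flip of the block of [j] is a limit of products with flips of other
    blocks. *)
Lemma normal_flip : exists j, N (tr (j, false) (j, true)).
Proof.
have [s sP] := double_transposition.
have [j js] := freshJ (map fst s); exists j.
apply: closed_approx => // s'.
have [i] := freshJ (j :: map fst (s ++ s')).
rewrite inE negb_or map_cat mem_cat negb_or => /and3P[ij is_ is'].
have nin k b (r : seq Om) : k \notin map fst r -> (k, b) \notin r.
  by apply: contra => kr; apply/mapP; exists (k, b).
exists (tr (j, false) (j, true) * tr (i, false) (i, true)); split.
- apply: sP; last by rewrite /= !nin.
  by rewrite /= !inE !negb_or /= !xpair_eqE /= !andbT ![j == i]eq_sym ij ?andbF.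
- move=> w ws'; rewrite actM twistM /= mulg1; split=> //; congr (swap _ _ _).
  by apply: swapD; apply: contraTneq ws' => ->; exact: nin.
- have swapq k w : (swap (k, false) (k, true) w).1 = w.1.
    by rewrite /swap; case: eqP => [->//|_]; case: eqP => [->|].
  by move=> w /=; rewrite !swapq.
Qed.

Lemma normal_tr x y : N (tr x y).
Proof.
have [->|xy] := eqVneq x y.
  suff -> : tr y y = 1 by exact: normal1.
  apply: twisted_perm_eq => // w /=.
  by rewrite /swap; case: eqP.
have [j Nj] := normal_flip; have ne : (j, false) != (j, true) by rewrite xpair_eqE andbF.
apply: (@swap_2transitive _ (fun x y => N (tr x y)) _ _ _ Nj ne) => // a b {xy}x {}y Nxy.
apply: normal_act (normal_conj (tr a b) Nxy) => w.
by rewrite act_conj_tr.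
Qed.

(** The subgroup [T ^ Om * U] is contained in [N]: an element of [U] agrees on
    each finite set with a product of transpositions inside blocks. *)
Lemma normal_block g : (forall w, (act g w).1 = w.1) -> N g.
Proof.
have Vq h : (forall w, (act h w).1 = w.1) -> forall w, (actV h w).1 = w.1.
  by move=> hq w; rewrite -{2}[w](actVK h) hq.
move=> gq; suff : N (diag (fun w => (twist g w)^-1) * g).
  by apply: normal_act.
apply: closed_approx => // s.
suff [n [Nn nq ns]] : exists n, [/\ N n, forall w, (act n w).1 = w.1 &
    forall w, w \in s -> act n w = act g w].
  exists (diag (fun w => (twist n w)^-1) * n); split.
  - exact: normal_act Nn.
  - by move=> w ws; rewrite !actM !twistM /= ns // !mulVg.
  - by move=> w; rewrite /= !Vq.
elim: s => [|a s [n [Nn nq ns]]]; first by exists 1; split=> //; exact: normal1.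
have [as_|as_] := boolP (a \in s).
  by exists n; split=> // w; rewrite inE => /predU1P[->|]; exact: ns.
exists (tr (act n a) (act g a) * n); split.
- by apply: normalM => //; exact: normal_tr.
- move=> w; rewrite actM /= /swap; case: eqP => [/act_inj->|_]; first exact: gq.
  by case: eqP => // ngw; rewrite -(nq w) ngw nq gq.
- move=> w; rewrite inE actM /= => /predU1P[->|ws]; first by rewrite swapL.
  have wa : w != a by apply: contraTneq ws => ->.
  by rewrite swapD ns // ?(inj_eq (@act_inj _ _ g)) // -ns // (inj_eq (@act_inj _ _ n)).
Qed.

(** By induction on a finite set [s] such that [g] preserves the blocks of the
    points outside [s] and maps the complement of [s] to itself.  If [a] is in
    [s], then [(a (g a)) g] fixes [a] and has the same property for
    [s] without [a]; the case of an empty [s] is [normal_block]. *)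
Lemma normal_all g : N g.
Proof.
suff main s : (forall w, w \notin s -> (act g w).1 = w.1 /\ act g w \notin s) -> N g.
  have [s gs] := act_near_seq g.
  (* the union of the blocks that meet s *)
  pose s' := [seq (j, b) | j <- map fst s, b <- [:: false; true]].
  have s'P w : (w \in s') = (w.1 \in map fst s).
    case: w => j b; apply/allpairsP/idP => [[[i c] [/= is_ _ [-> _]]]//|js].
    by exists (j, b); split=> //=; case: (b).
  apply: (main s') => w; rewrite !s'P => ws; rewrite gs; last first.
    by apply: contra ws => ws; apply/mapP; exists w.
  by [].
elim: s g => [|a s IH] g gs; first by apply: normal_block => w; case: (gs w).
have gsn w : w != a -> w \notin s ->
    [/\ (act g w).1 = w.1, act g w != a & act g w \notin s].
  move=> wa ws; have [|gw] := gs w; first by rewrite inE negb_or wa.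
  by rewrite inE negb_or => /andP[].
suff Nh : N (tr a (act g a) * g).
  apply: normal_act (normalM (normal_tr a (act g a)) Nh) => w.
  by rewrite /= swapK.
apply: IH => w; have [->|wa] := eqVneq w a; first by rewrite actM /= swapR.
move=> /(gsn _ wa)[gq ga gns]; rewrite actM /= swapD //.
by rewrite (inj_eq (@act_inj _ _ g)).
Qed.

End Moving.

Lemma normal_dichotomy : (exists g, ~ N g) -> forall n, N n -> act n =1 id.
Proof.
move=> [g Ng] n Nn w; apply/eqP/negPn/negP => nw.
exact/Ng/(normal_all Nn nw).
Qed.

End Dichotomy.

(** * Cardinalities *)

Section Cardinality.
Local Open Scope classical_set_scope.
Local Open Scope card_scope.

Lemma card_le_total (X Y : Type) (A : set X) (B : set Y) : A #<= B \/ B #<= A.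
Proof.
pose F : set (set (X + Y)) := [set inl @` A] `|` [set inr @` B].
have eA : (@inl X Y) @` A #= A by apply: inj_card_eq => x y _ _ [].
have eB : (@inr X Y) @` B #= B by apply: inj_card_eq => x y _ _ [].
have [|C [[->|->] Cle]] := @least_card_ex _ F; first by exists (inl @` A); left.
- left; have := Cle (inr @` B) (or_intror erefl).
  by rewrite (card_le_eql eA) (card_le_eqr eB).
- right; have := Cle (inl @` A) (or_introl erefl).
  by rewrite (card_le_eql eB) (card_le_eqr eA).
Qed.

Lemma infinite_injection (X : Type) : infinite_set [set: X] ->
  exists k : nat -> X, injective k.
Proof.
elim/Ppointed: X => X; first by rewrite emptyE_subdef.
move=> /infiniteP/pcard_injP[k kinj]; exists k => m n.
by apply: kinj; rewrite inE.
Qed.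

Lemma Cantor_injection (X : Type) (f : set X -> X) : ~ injective f.
Proof.
move=> finj; pose A := [set x | exists2 B : set X, f B = x & ~ B x].
have AfA : ~ A (f A) by move=> AfA; have [B /finj -> //] := AfA.
by apply: (AfA); exists A.
Qed.

(** If [B] had at most [2 ^ M] elements, [j] could be recovered from the subset
    of [M] coding [f j] and from the index of [j] in an enumeration of its fiber,
    coded by an element of [M].  Both are recorded in one subset of [M * bool]. *)
Lemma card_le_finite_fibers (M X : Type) (B : set X)
    (f : set (set (M * bool)) -> X) : infinite_set [set: M] ->
  (forall j, B (f j)) ->
  (forall V, B V -> exists s : seq (set (set (M * bool))),
     forall j, f j = V -> j \in s) ->
  [set: set M] #<= B.
Proof.
move=> /infinite_injection[k kinj] Bf fib.
have [//|/pcard_injP[e einj]] := card_le_total [set: set M] B.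
have /choice[s sP] V : exists s : seq (set (set (M * bool))),
    B V -> forall j, f j = V -> j \in s.
  have [/fib[s sP]|nBV] := pselect (B V); first by exists s.
  by exists [::].
pose phi j : set (M * bool) := [set x | if x.2 then e (f j) x.1
  else x.1 = k (index j (s (f j)))].
case: (@Cantor_injection _ phi) => i j ij.
have fij : f i = f j.
  apply: einj; rewrite ?inE //; apply/seteqP; split=> m em.
    by have : phi i (m, true) by []; rewrite ij.
  by have : phi j (m, true) by []; rewrite -ij.
have : phi i (k (index i (s (f i))), false) by [].
rewrite ij /phi /= fij => /kinj.
by apply: (index_inj i); exact: sP.
Qed.

End Cardinality.

(** * Quotients by subgroups that act trivially *)

Section Quotient.
Local Open Scope classical_set_scope.
Local Open Scope card_scope.
Local Open Scope group_scope.
Local Open Scope quotient_scope.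
Context {J : choiceType} {T : topologicalGroupType}.
Local Notation Om := (J * bool)%type.
Local Notation G := (twisted_perm J T).
Variable NS : normalSubgroup G.
Hypothesis NSid : forall n, normal_set NS n -> act n =1 id.
Local Notation Q := (quotient_group NS).

(** The action of [G / N] on [J * bool], which is well defined because [N] acts
    trivially. *)
Definition quot_act (a : Q) w : Om := act (repr a) w.

Lemma quot_act_pi g w : quot_act (\pi_Q g) w = act g w.
Proof.
have /quot_eqP/NSid/(_ w) : \pi_Q (repr (\pi_Q g)) = \pi_Q g by rewrite reprK.
by rewrite /quot_act actM act_inv => gw; rewrite -{1}gw actVK.
Qed.

Lemma open_quot_act w v : open [set a : Q | quot_act a w = v].
Proof.
rewrite /open /= /quotient_open.
suff -> : \pi_Q @^-1` [set a | quot_act a w = v] = [set g : G | act g w = v].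
  exact: open_act.
by apply/seteqP; split=> g /=; rewrite quot_act_pi.
Qed.

(** The action on one point of [J * bool] is a locally constant surjection. *)
Lemma quotient_density (M : Type) (i : M -> J) : injective i ->
  [set: M] #<= density Q.
Proof.
move=> iinj; have [[m0 _]|/forallNP M0] := pselect (exists _ : M, True); last first.
  suff -> : [set: M] = set0 by [].
  by apply/seteqP; split=> // m _; case: (M0 m).
pose w0 := (i m0, true).
have [dD _] := @densityP Q.
have iM : (fun m => (i m, true)) @` [set: M] #= [set: M].
  by apply: inj_card_eq => m n _ _ [/iinj].
rewrite -(card_le_eql iM).
apply: card_le_trans (card_image_le (quot_act ^~ w0) (density Q)).
apply: subset_card_le => _ [m _ <-].
have [|a [aw Da]] := dD _ _ (@open_quot_act w0 (i m, true)); last by exists a.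
by exists (\pi_Q (tr w0 (i m, true))); rewrite /= quot_act_pi /= swapL.
Qed.

(** If [j] is not the block of one of the finitely many points that a basic
    neighbourhood of 1 inside the preimage of [V] controls, then the flip of the
    block of [j] is in this neighbourhood. *)
Lemma quotient_base_fibers (V : set Q) : nbhs (1 : Q) V ->
  exists s : seq J, forall j,
    V `<=` [set a | quot_act a (j, false) = (j, false)] -> j \in s.
Proof.
move=> /(@pi_continuous _ _ (1 : G))[s [U [U1 sUV]]].
exists (map fst s) => j Vj; apply: contrapT => /negP js.
have nin b : (j, b) \notin s.
  by apply: contra js => js; apply/mapP; exists (j, b).
have : V (\pi_Q (tr (j, false) (j, true))).
  apply: sUV => w /= => [ws|].
    split; last exact: (nbhs_singleton (U1 w)).
    by apply: swapD; apply: contraTneq ws => ->.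
  by rewrite /swap; case: eqP => [->//|_]; case: eqP => [->|].
by move=> /Vj /=; rewrite quot_act_pi /= swapL => -[].
Qed.

End Quotient.

Section LocalWeight.
Local Open Scope classical_set_scope.
Local Open Scope card_scope.
Local Open Scope group_scope.

Lemma quotient_local_weight (M : Type) (T : topologicalGroupType)
    (NS : normalSubgroup (twisted_perm (set (set (M * bool))) T)) :
  infinite_set [set: M] ->
  (forall n, normal_set NS n -> act n =1 id) ->
  [set: set M] #<= local_weight (quotient_group NS).
Proof.
move=> infM NSid; set Q := quotient_group NS.
have [[Bn BV] _] := @local_weightP Q.
have /choice[f fP] j : exists V : set Q, local_weight Q V /\
    V `<=` [set a | quot_act a (j, false) = (j, false)].
  have [|V BV1 Vj] := BV [set a : Q | quot_act a (j, false) = (j, false)].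
    apply: open_nbhs_nbhs; split; first exact: open_quot_act.
    exact: (quot_act_pi NSid 1).
  by exists V.
apply: (@card_le_finite_fibers M _ _ f) => //
  [j|V /Bn /(quotient_base_fibers NSid)[s sP]].
  by case: (fP j).
by exists s => j fj; apply: sP; rewrite -fj; case: (fP j).
Qed.

End LocalWeight.

(** * The circle group *)

Section Circle.
Import Order.TTheory GRing.Theory Num.Theory numFieldNormedType.Exports.
Local Open Scope classical_set_scope.
Local Open Scope ring_scope.
Context {R : realType}.

Definition unit_circle : set (R * R) := [set z | z.1 ^+ 2 + z.2 ^+ 2 = 1].

(** The unit circle of the plane, with the subspace topology and the
    multiplication of complex numbers. *)
Definition circle := set_type unit_circle.

HB.instance Definition _ := Topological.on circle.

Definition mk_circle z (zC : unit_circle z) : circle := SigSub (mem_set zC).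

Lemma circleP (z : circle) : (set_val z).1 ^+ 2 + (set_val z).2 ^+ 2 = 1.
Proof. exact: (set_valP z). Qed.

Lemma circle_val_continuous : continuous (set_val : circle -> R * R).
Proof. exact: initial_continuous. Qed.

Lemma continuous_to_circle (X : topologicalType) (f : X -> circle) :
  continuous (fun x => (set_val (f x)).1) ->
  continuous (fun x => (set_val (f x)).2) -> continuous f.
Proof.
move=> f1 f2; apply: (@continuous_comp_initial _ _ _ (set_val : circle -> R * R)).
move=> x A [[B1 B2] /= [n1 n2] BA].
have fA : (fun y => (set_val (f y)).1) @^-1` B1 `&`
    (fun y => (set_val (f y)).2) @^-1` B2 `<=` (set_val \o f) @^-1` A.
  by move=> y B12; exact: (BA (set_val (f y))).
exact: (filterS fA (filterI (f1 x _ n1 : nbhs x _) (f2 x _ n2 : nbhs x _))).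
Qed.

Lemma circle_one_subproof : unit_circle (1, 0).
Proof. by rewrite /unit_circle /=; ring. Qed.

Definition circle_one : circle := mk_circle circle_one_subproof.

Lemma circle_inv_subproof (z : circle) :
  unit_circle ((set_val z).1, - (set_val z).2).
Proof. by rewrite /unit_circle /= sqrrN circleP. Qed.

Definition circle_inv z : circle := mk_circle (circle_inv_subproof z).

Lemma circle_mul_subproof (z w : circle) : unit_circle
  ((set_val z).1 * (set_val w).1 - (set_val z).2 * (set_val w).2,
   (set_val z).1 * (set_val w).2 + (set_val z).2 * (set_val w).1).
Proof.
rewrite /unit_circle /=; transitivity (((set_val z).1 ^+ 2 + (set_val z).2 ^+ 2) *
  ((set_val w).1 ^+ 2 + (set_val w).2 ^+ 2)); first by ring.
by rewrite !circleP mulr1.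
Qed.

Definition circle_mul z w : circle := mk_circle (circle_mul_subproof z w).

Lemma circle_eq (z w : circle) : (set_val z).1 = (set_val w).1 ->
  (set_val z).2 = (set_val w).2 -> z = w.
Proof.
move=> e1 e2; apply: val_inj; rewrite -!set_valE.
by rewrite [LHS]surjective_pairing [RHS]surjective_pairing e1 e2.
Qed.

Lemma circle_mulC : commutative circle_mul.
Proof. by move=> z w; apply: circle_eq => /=; ring. Qed.

Lemma circle_mulA : associative circle_mul.
Proof. by move=> z w u; apply: circle_eq => /=; ring. Qed.

Lemma circle_mul1 : left_id circle_one circle_mul.
Proof. by move=> z; apply: circle_eq => /=; ring. Qed.

Lemma circle_mulr1 : right_id circle_one circle_mul.
Proof. by move=> z; rewrite circle_mulC circle_mul1. Qed.

Lemma circle_mulV : left_inverse circle_one circle_inv circle_mul.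
Proof.
move=> z; apply: circle_eq => /=; last by ring.
by rewrite -[RHS](circleP z); ring.
Qed.

Lemma circle_mulrV : right_inverse circle_one circle_inv circle_mul.
Proof. by move=> z; rewrite circle_mulC circle_mulV. Qed.

HB.instance Definition _ := isGroup.Build circle
  circle_mulA circle_mul1 circle_mulr1 circle_mulV circle_mulrV.

Lemma circle_fst_continuous : continuous (fun z : circle => (set_val z).1).
Proof.
move=> z; apply: (@cvg_comp _ _ _ set_val fst); first exact: circle_val_continuous.
exact: cvg_fst.
Qed.

Lemma circle_snd_continuous : continuous (fun z : circle => (set_val z).2).
Proof.
move=> z; apply: (@cvg_comp _ _ _ set_val snd); first exact: circle_val_continuous.
exact: cvg_snd.
Qed.

Lemma circle_mul_continuous :
  continuous (fun x : circle * circle => (x.1 * x.2)%g).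
Proof.
have L (f : circle -> R) : continuous f -> continuous (fun x : circle * circle => f x.1).
  move=> cf x; apply: (@cvg_comp _ _ _ fst f); first exact: cvg_fst.
  exact: cf.
have M (f : circle -> R) : continuous f -> continuous (fun x : circle * circle => f x.2).
  move=> cf x; apply: (@cvg_comp _ _ _ snd f); first exact: cvg_snd.
  exact: cf.
have [f s] := (circle_fst_continuous, circle_snd_continuous).
apply: continuous_to_circle => x /=.
  apply: cvgB; apply: cvgM; [exact: (L _ f)|exact: (M _ f)|exact: (L _ s)|exact: (M _ s)].
apply: cvgD; apply: cvgM; [exact: (L _ f)|exact: (M _ s)|exact: (L _ s)|exact: (M _ f)].
Qed.

Lemma circle_inv_continuous : continuous (fun z : circle => z^-1%g).
Proof.
apply: continuous_to_circle => z /=; first exact: circle_fst_continuous.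
exact: (cvgN (@circle_snd_continuous z)).
Qed.

HB.instance Definition _ := isTopologicalGroup.Build circle
  circle_mul_continuous circle_inv_continuous.

Lemma circle_hausdorff : hausdorff_space circle.
Proof.
move=> z w zw; apply: circle_eq; apply: Rhausdorff => A B Az Bw.
  have [u [Au Bu]] := zw _ _ (circle_fst_continuous Az) (circle_fst_continuous Bw).
  by exists (set_val u).1.
have [u [Au Bu]] := zw _ _ (circle_snd_continuous Az) (circle_snd_continuous Bw).
by exists (set_val u).2.
Qed.

Lemma sqr1D_gt0 (t : R) : 0 < 1 + t ^+ 2.
Proof. by rewrite ltr_wpDr ?sqr_ge0. Qed.

Lemma circle_param_subproof (e t : R) : e ^+ 2 = 1 -> unit_circle
  (e * ((1 - t ^+ 2) / (1 + t ^+ 2)), e * (2 * t / (1 + t ^+ 2))).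
Proof.
move=> e1; rewrite /unit_circle /= !exprMn e1.
by field; rewrite gt_eqF // sqr1D_gt0.
Qed.

(** The rational parametrization of the circle minus [(- e, 0)], for a sign
    [e]: the right half of the circle if [e = 1] and the left half if [e = - 1] are
    the images of [[-1, 1]]. *)
Definition circle_param (e : R) (e1 : e ^+ 2 = 1) (t : R) : circle :=
  mk_circle (circle_param_subproof t e1).
Arguments circle_param {e} e1 t.

Lemma circle_param_continuous (e : R) (e1 : e ^+ 2 = 1) :
  continuous (circle_param e1).
Proof.
have ct2 : continuous (fun t : R => t ^+ 2) by move=> t; apply: cvgM; exact: cvg_id.
have cV : continuous (fun t : R => (1 + t ^+ 2)^-1).
  move=> t; apply: cvgV; first by rewrite gt_eqF // sqr1D_gt0.
  by apply: cvgD; [exact: cvg_cst|exact: ct2].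
apply: continuous_to_circle => t /=; apply: cvgM; try exact: cvg_cst.
  by apply: cvgM; [apply: cvgB; [exact: cvg_cst|exact: ct2]|exact: cV].
by apply: cvgM; [apply: cvgM; [exact: cvg_cst|exact: cvg_id]|exact: cV].
Qed.

Lemma circle_compact : compact [set: circle].
Proof.
have e1 : (1 : R) ^+ 2 = 1 by rewrite expr1n.
have e2 : (-1 : R) ^+ 2 = 1 by rewrite sqrrN expr1n.
have c e (h : e ^+ 2 = 1) : compact (circle_param h @` `[-1, 1]).
  have ch := @circle_param_continuous e h.
  exact: (continuous_compact (continuous_subspaceT ch) (@segment_compact R _ _)).
suff -> : [set: circle] = (circle_param e1 @` `[-1, 1]) `|`
    (circle_param e2 @` `[-1, 1]) by apply: compactU; exact: c.
have P e (h : e ^+ 2 = 1) (z : circle) : 0 <= e * (set_val z).1 ->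
    (circle_param h @` `[-1, 1]) z.
  have := circleP z; set x := (set_val z).1; set y := (set_val z).2 => xy ex.
  have d0 : 0 < 1 + e * x by rewrite ltr_wpDr.
  (* the parameter is the tangent of half the argument of (e * x, e * y) *)
  exists (e * y / (1 + e * x)).
    rewrite /= in_itv /= ler_pdivlMr // ler_pdivrMr // mul1r mulN1r.
    by apply/andP; split; nra.
  have d_neq0 : 1 + e * x != 0 by rewrite gt_eqF.
  have t2 : (e * y / (1 + e * x)) ^+ 2 = (1 - e * x) / (1 + e * x).
    have -> : 1 - e * x = (e * y) ^+ 2 / (1 + e * x).
      have -> : (e * y) ^+ 2 = (1 - e * x) * (1 + e * x) by rewrite exprMn h; nra.
      by rewrite mulfK.
    by field.
  apply: circle_eq => /=; rewrite t2 -/x -/y.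
    transitivity (e ^+ 2 * x); last by rewrite h mul1r.
    by field; rewrite d_neq0 /=; apply/negP => /eqP; lra.
  transitivity (e ^+ 2 * y); last by rewrite h mul1r.
  by field; rewrite d_neq0 /=; apply/negP => /eqP; lra.
apply/seteqP; split=> // z _.
have [x0|x0] := leP 0 (set_val z).1; first by left; apply: P; rewrite mul1r.
by right; apply: P; rewrite mulN1r oppr_ge0 ltW.
Qed.

Lemma circle_arc : exists (C : set circle) a b,
  [/\ connected C, C a, C b & a <> b].
Proof.
have e1 : (1 : R) ^+ 2 = 1 by rewrite expr1n.
exists (circle_param e1 @` `[0, 1]), (circle_param e1 0), (circle_param e1 1).
split.
- have c1 := @circle_param_continuous _ e1.
  exact: (connected_continuous_connected (@segment_connected R _ _)
    (continuous_subspaceT c1)).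
- by exists 0 => //=; rewrite in_itv /= lexx ler01.
- by exists 1 => //=; rewrite in_itv /= lexx ler01.
- move=> /(congr1 (fun z => (set_val z).2)) /=.
  have two : 2 / (1 + 1) = 1 :> R by rewrite divff // pnatr_eq0.
  by rewrite expr1n mulr1 two; lra.
Qed.

End Circle.

(** * Groups with large quotients *)

Local Open Scope classical_set_scope.
Local Open Scope card_scope.

Theorem theoremA2 (M : Type) (M_infinite : infinite_set [set: M]) :
  exists G : topologicalGroupType,
    [/\ hausdorff_space G,
        locally_compact [set: G],
        ~ totally_disconnected [set: G] &
        forall N : normalSubgroup G, closed (N : set G) ->
          [set: quotient_group N] <> [set 1%g] ->
          [set: set M] #<= local_weight (quotient_group N) /\
          [set: M] #<= density (quotient_group N)].
Proof.
pose J : choiceType := set (set (M * bool)).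
pose T : topologicalGroupType := @circle Rdefinitions.R.
(* any embedding of M into J will do *)
pose i (m : M) : J := [set [set (m, true)]].
have i_inj : injective i.
  move=> m n mn; have : i n [set (m, true)] by rewrite -mn.
  move=> mn'; have : [set (n, true)] (m, true) by rewrite -mn'.
  by case.
have J_infinite : infinite_set [set: J].
  have iM : i @` [set: M] #= [set: M] by apply: inj_card_eq => m n _ _ /i_inj.
  move=> finJ; apply: M_infinite; apply: card_le_finite finJ.
  by rewrite -(card_le_eql iM); exact: subset_card_le.
exists (twisted_perm J T : topologicalGroupType); split.
- exact/tp_hausdorff/circle_hausdorff.
- by apply: tp_locally_compact; [exact: circle_compact|exact: circle_hausdorff].
- have [C [a [b [cC Ca Cb ab]]]] := @circle_arc Rdefinitions.R.
  exact: (@tp_not_totally_disconnected J T set0 C a b).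
move=> N clN Q1.
have Nact : forall n, normal_set N n -> act n =1 id.
  apply: (normal_dichotomy J_infinite (@circle_mulC _) clN).
  apply: contrapT => /forallNP allN; apply: Q1.
  apply/seteqP; split=> // a _; apply: (quot_ind (N := N) _ a) => g.
  by apply/esym/quot_eqP; rewrite invg1 mul1g; exact: contrapT (allN g).
split; first exact: quotient_local_weight.
exact: (quotient_density Nact i_inj).
Qed.
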